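(* Let $[a^*,b,p^*]$ be an $(\alpha,\beta)$-A-CEEI calculated using $\varepsilon$-approximations $\{\hat u_i\}_{i\in N}$ of the true utility functions $\{u_i\}_{i\in N}$. Then: 1. If $\beta\le\frac{1}{k-1}$, with $k$ being the maximum number of courses per student, then $a^*$ satisfies envy $2\varepsilon$-bounded by a single good with respect to the true utility functions $\{u_i\}_{i\in N}$. Moreover, this bound is tight. 2. If there exists some $\delta\ge 0$ such that $p^*\in\mathcal P(\delta,b)$ and $\beta<\frac{1-\delta n}{n(1+\delta)}$, then $a^*$ satisfies the $(n+1,2\varepsilon)$-maximin share guarantee with respect to the true utility functions $\{u_i\}_{i\in N}$. Moreover, this bound is tight. 3. Given $p^*$, the true utility of every student $i\in N$ for the schedule she receives in the allocation $a^*$ (i.e., $u_i(a_i^* )$) is within $2\varepsilon$ of her true utility for her most preferred (permissible) schedule she could afford. 4. Given $p^*$, the allocation $a^*$ is $2\varepsilon$-Pareto efficient with respect to the true utility functions $\{u_i\}_{i\in N}$, i.e., there is no $a'\in\mathcal F$ such that for all $i\in N$ it holds that $u_i(a_i')>u_i(a_i^* )+2\varepsilon$.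
   Context: $N=\{1,\dots,n\}$ is the set of students and $M=\{1,\dots,m\}$ the set of courses; course $j$ has capacity $q_j\in\mathbb N_{>0}$. A schedule is a vector $x\in\mathcal X=\{0,1\}^m$, identified with the set of courses $\{j:x_j=1\}$. Student $i$ has a set $\Psi_i$ of permissible schedules and a true utility function $u_i:\mathcal X\to\mathbb R_+$. An allocation is $a=(a_i)_{i\in N}\in\mathcal X^n$, where $a_i$ is student $i$'s schedule. The set of feasible allocations is $\mathcal F=\{a\in\mathcal X^n:\ \sum_{i=1}^n a_{ij}\le q_j\ \forall j\in M,\ a_i\in\Psi_i\ \forall i\in N\}$. $\varepsilon$-approximation: for $\varepsilon\ge 0$, a function $\hat u$ is an $\varepsilon$-approximation of $u:\{0,1\}^m\to\mathbb R$ if $\sup_{x\in\{0,1\}^m}|\hat u(x)-u(x)|<\varepsilon$. $(\alpha,\beta)$-A-CEEI (approximate competitive equilibrium from equal incomes) calculated using $\{\hat u_i\}$: a triple $[a^*,b,p^*]$ of an allocation $a^*$, budgets $b_i\in[1,1+\beta]$ with $\beta>0$, and prices $p^*\in\mathbb R^m_{\ge 0}$ such that (i) each $a_i^*$ maximizes $\hat u_i$ over the permissible schedules $x\in\Psi_i$ with $\sum_j x_jp_j^*\le b_i$ (the schedules student $i$ can afford); and (ii) prices approximately clear the market: with clearing errors $z_j=\sum_i a^*_{ij}-q_j$ if $p_j^*>0$ and $z_j=\max\{\sum_i a^*_{ij}-q_j,0\}$ if $p_j^*=0$, the clearing error $\alpha=\sqrt{\sum_j z_j^2}$ satisfies $\alpha\le\sqrt{\sigma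 m}/2$, where $\sigma=\min\{2k,m\}$ and $k$ is the maximum number of courses in a permissible schedule. $\mathcal P(\delta,b)=\{p\in[0,\max_i b_i]^m:\ \sum_j p_jq_j\le\sum_i b_i(1+\delta)\}$. Envy $\eta$-bounded by a single good: an allocation $a$ satisfies this if for all $i,i'\in N$ either $u_i(a_i)\ge u_i(a_{i'})-\eta$, or there exists some $j\in a_{i'}$ such that $u_i(a_i)\ge u_i(a_{i'}\setminus\{j\})-\eta$. $l$-maximin share: let $Z^*$ be an $l$-maximin split of student $i$, i.e., a maximizer of $\min_{r\in\{1,\dots,l\}}u_i(z_r)$ over all $\{z_1,\dots,z_l\}$ with $z_r\in\mathcal X$ and $\sum_{r=1}^l z_{rj}\le q_j$ for every course $j$. Student $i$'s $l$-maximin share is a schedule in $Z^*$ minimizing $u_i$. For $\eta\ge 0$, student $i$'s $(l,\eta)$-maximin share is any schedule whose $u_i$-utility is at least the $u_i$-utility of her $l$-maximin share minus $\eta$. A feasible allocation $a\in\mathcal F$ satisfies the $(l,\eta)$-maximin share guarantee if all students $i\in N$ get a schedule $a_i$ they weakly prefer (with respect to their true utility functions) to their $(l,\eta)$-maximin share, i.e., $u_i(a_i)\ge u_i(\text{her }l\text{-maximin share})-\eta$.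
   Formalization: Items 1 and 2 assume each schedule has true utility 0 or at most that of a permissible subschedule; item 4 compares a* only with feasible a' whose total cost at p* is at most the sum of budgets. Without these the claims fail. Feasibility of a* is not part of the maximin guarantee. *)

(* Defs.v *)
From mathcomp Require Import all_boot all_order all_algebra.

Set Implicit Arguments.
Unset Strict Implicit.
Unset Printing Implicit Defensive.

Import Order.TTheory GRing.Theory Num.Theory.
Local Open Scope ring_scope.

(* A vector of {0,1}^m is identified with the set of courses on which it is 1,
   so that the entry x_j is the boolean j \in x. *)
Definition schedule (m : nat) := {set 'I_m}.

Definition allocation (n m : nat) := 'I_n -> schedule m.

Record market (R : rcfType) (n m : nat) := Market {
  cap : 'I_m -> nat;
  permissible : 'I_n -> {set schedule m};
  util : 'I_n -> schedule m -> R;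
  students_gt0 : (0 < n)%N;
  cap_gt0 : forall j, (0 < cap j)%N;
  util_ge0 : forall i x, 0 <= util i x
}.

(* How utilities extend to impermissible schedules: a schedule is worth nothing,
   or no more than some permissible schedule contained in it.  Both usual
   conventions are instances: impermissible schedules have utility 0, or they
   have the utility of their best permissible subschedule. *)
Definition permissible_worth (R : rcfType) (n m : nat) (E : market R n m) :=
  forall i x, util E i x = 0 \/
    exists y, [/\ y \in permissible E i, y \subset x & util E i x <= util E i y].

Definition max_courses (R : rcfType) (n m : nat) (E : market R n m) : nat :=
  (\max_(i < n) \max_(x in permissible E i) #|x|)%N.

Definition enrolled (n m : nat) (a : allocation n m) (j : 'I_m) : nat :=
  (\sum_(i < n) (j \in a i))%N.

Definition feasible (R : rcfType) (n m : nat) (E : market R n m)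
    (a : allocation n m) :=
  (forall j, (enrolled a j <= cap E j)%N) /\
  (forall i, a i \in permissible E i).

Definition eps_approx (R : rcfType) (m : nat) (eps : R) (v u : schedule m -> R) :=
  \big[Order.max/0]_(x : schedule m) `|v x - u x| < eps.

Definition cost (R : rcfType) (m : nat) (p : 'I_m -> R) (x : schedule m) : R :=
  \sum_(j in x) p j.

Definition optimal (R : rcfType) (m : nat) (v : schedule m -> R)
    (Psi : {set schedule m}) (p : 'I_m -> R) (c : R) (x : schedule m) :=
  [/\ x \in Psi, cost p x <= c &
      forall y, y \in Psi -> cost p y <= c -> v y <= v x].

Definition clearing_error (R : rcfType) (n m : nat) (E : market R n m)
    (a : allocation n m) (p : 'I_m -> R) (j : 'I_m) : R :=
  let excess := (enrolled a j)%:R - (cap E j)%:R in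
  if 0 < p j then excess else Order.max excess 0.

Definition is_aceei (R : rcfType) (n m : nat) (E : market R n m)
    (v : 'I_n -> schedule m -> R) (alpha beta : R)
    (a : allocation n m) (b : 'I_n -> R) (p : 'I_m -> R) :=
  let sigma := minn (2 * max_courses E)%N m in
  [/\ 0 < beta /\ (forall i, 1 <= b i <= 1 + beta),
      forall j, 0 <= p j,
      forall i, optimal (v i) (permissible E i) p (b i) (a i),
      alpha = Num.sqrt (\sum_(j < m) clearing_error E a p j ^+ 2) &
      alpha <= Num.sqrt (sigma * m)%N%:R / 2].

(* The set P(delta, b); the default 0 of the maximum is irrelevant for n > 0 and
   positive budgets. *)
Definition bounded_prices (R : rcfType) (n m : nat) (E : market R n m)
    (delta : R) (b : 'I_n -> R) (p : 'I_m -> R) :=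
  (forall j, 0 <= p j <= \big[Order.max/0]_(i < n) b i) /\
  \sum_(j < m) p j * (cap E j)%:R <= \sum_(i < n) b i * (1 + delta).

Definition envy_bounded (R : rcfType) (n m : nat) (E : market R n m) (eta : R)
    (a : allocation n m) :=
  forall i i' : 'I_n,
    util E i (a i) >= util E i (a i') - eta \/
    exists2 j, j \in a i' & util E i (a i) >= util E i (a i' :\ j) - eta.

(* Splits range over all schedules, permissible or not. *)
Definition is_split (R : rcfType) (n m : nat) (E : market R n m) (l : nat)
    (z : l.-tuple (schedule m)) :=
  forall j, (\sum_(x <- z) (j \in x) <= cap E j)%N.

(* min_r u(z_r); the initial value u(z_1) makes it the minimum for l > 0 *)
Definition min_util (R : rcfType) (m l : nat) (u : schedule m -> R)
    (z : l.-tuple (schedule m)) : R :=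
  \big[Order.min/u (head set0 z)]_(x <- z) u x.

Definition maximin_split (R : rcfType) (n m : nat) (E : market R n m) (l : nat)
    (i : 'I_n) (z : l.-tuple (schedule m)) :=
  is_split E z /\
  forall z' : l.-tuple (schedule m), is_split E z' ->
    min_util (util E i) z' <= min_util (util E i) z.

Definition maximin_share (R : rcfType) (n m : nat) (E : market R n m) (l : nat)
    (i : 'I_n) (s : schedule m) :=
  exists z : l.-tuple (schedule m),
    [/\ maximin_split E i z, s \in z &
        forall x, x \in z -> util E i s <= util E i x].

(* Membership of a in the feasible set is not part of this property: the
   allocation of an approximate equilibrium may exceed capacities. *)
Definition maximin_guarantee (R : rcfType) (n m : nat) (E : market R n m)
    (l : nat) (eta : R) (a : allocation n m) :=
  forall i s, maximin_share E l i s -> util E i (a i) >= util E i s - eta.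

(* No feasible allocation that can be paid for at prices p out of the students'
   total budget makes every student better off by more than eta.  This covers
   the allocations affordable to each student separately, and those using no
   more seats of each course than a does.  Without the restriction to p, excess
   supply of positively priced courses would allow further improvements. *)
Definition pareto_efficient_at (R : rcfType) (n m : nat) (E : market R n m)
    (eta : R) (b : 'I_n -> R) (p : 'I_m -> R) (a : allocation n m) :=
  ~ exists a' : allocation n m,
      [/\ feasible E a',
          \sum_(i < n) cost p (a' i) <= \sum_(i < n) b i &
          forall i, util E i (a' i) > util E i (a i) + eta].

(* 1/(k-1) is read as +oo when k <= 1. *)
Definition envy_budget_condition (R : rcfType) (n m : nat) (E : market R n m)
    (beta : R) :=
  (1 < max_courses E)%N -> beta <= 1 / ((max_courses E)%:R - 1).

Definition maximin_budget_condition (R : rcfType) (n m : nat)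
    (E : market R n m) (beta delta : R) (b : 'I_n -> R) (p : 'I_m -> R) :=
  [/\ 0 <= delta, bounded_prices E delta b p &
      beta < (1 - delta * n%:R) / (n%:R * (1 + delta))].

(* Main.v *)
(** A student never regrets an affordable schedule by more than [2 * eps]: pass
    from [u] to [v] and back, losing [eps] each time.  Hence it suffices to
    find affordable schedules.  For envy, if no schedule [a i' :\ j] were
    affordable, averaging over [j] would give [a i'] a cost above [1 + beta].
    For the maximin share, a split into [n + 1] schedules costs less than
    [n + 1] in total, so one of its parts costs less than [1].  For Pareto
    efficiency, an improvement would cost everyone more than her budget.

    Both bounds are attained in one market with free courses, where a student
    to whom every nonempty schedule is worth some [t] in [(eta, 2 * eps)]
    reports the constant [t / 2] and receives nothing. *)

Require Import Defs.
From mathcomp Require Import all_boot all_order all_algebra.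
From mathcomp Require Import lra.

Set Implicit Arguments.
Unset Strict Implicit.
Unset Printing Implicit Defensive.

Import Order.TTheory GRing.Theory Num.Theory.
Local Open Scope ring_scope.

(** * Pointwise errors, monotone costs and schedule sizes *)

Lemma eps_approxP (R : rcfType) m (eps : R) (v u : schedule m -> R) x :
  eps_approx eps v u -> `|v x - u x| < eps.
Proof. by apply: le_lt_trans; apply: le_bigmax_cond. Qed.

Lemma cost_subset (R : rcfType) m (p : 'I_m -> R) (x y : schedule m) :
  (forall j, 0 <= p j) -> x \subset y -> cost p x <= cost p y.
Proof.
move=> p0 xy; rewrite /cost [leRHS](big_setID x) /= (setIidPr xy).
by rewrite lerDl sumr_ge0.
Qed.

Lemma card_permissible (R : rcfType) n m (E : market R n m) i x :
  x \in permissible E i -> (#|x| <= max_courses E)%N.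
Proof.
by move=> xi; apply: (bigop.bigmax_sup i) => //; apply: (bigop.bigmax_sup x).
Qed.

(** * The four guarantees at an approximate equilibrium *)

Section Equilibrium.
Variables (R : rcfType) (n m : nat) (E : market R n m).
Variables (v : 'I_n -> schedule m -> R) (eps alpha beta : R).
Variables (a : allocation n m) (b : 'I_n -> R) (p : 'I_m -> R).
Hypothesis eps_ge0 : 0 <= eps.
Hypothesis approx : forall i, eps_approx eps (v i) (util E i).
Hypothesis eqm : is_aceei E v alpha beta a b p.

Lemma near_optimal i x : x \in permissible E i -> cost p x <= b i ->
  util E i x <= util E i (a i) + 2 * eps.
Proof.
move=> xi xb; have [_ _ opt _ _] := eqm; have [_ _ /(_ x xi xb) le_v] := opt i.
have := eps_approxP x (approx i); have := eps_approxP (a i) (approx i).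
by rewrite !ltr_norml => /andP[? ?] /andP[? ?]; lra.
Qed.

(** Covers schedules that may be impermissible, such as [a i' :\ j] or a part of a split. As prices
    are nonnegative, a permissible subschedule that is worth as much is affordable too; a worthless
    schedule causes no regret. *)
Lemma near_optimal_worth i x : permissible_worth E -> cost p x <= b i ->
  util E i x <= util E i (a i) + 2 * eps.
Proof.
move=> pw xb; have [_ p0 _ _ _] := eqm.
have [-> | [y [yi yx le_u]]] := pw i x.
  by rewrite addr_ge0 ?util_ge0 ?mulr_ge0.
apply: le_trans le_u (near_optimal yi _).
exact: le_trans (cost_subset p0 yx) xb.
Qed.

Lemma aceei_envy : permissible_worth E -> envy_budget_condition E beta ->
  envy_bounded E (2 * eps) a.
Proof.
move=> pw hbeta i i'.
have [[beta_gt0 hb] p0 opt _ _] := eqm; have [ai' cost_ai' _] := opt i'.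
have /andP[bi _] := hb i; have /andP[_ bi'] := hb i'.
have [le_b | gt_b] := leP (cost p (a i')) (b i).
  by left; rewrite lerBlDr near_optimal_worth.
right; case: (pickP [pred j in a i' | cost p (a i' :\ j) <= b i]).
  by move=> j /andP[ja le_b]; exists j; rewrite // lerBlDr near_optimal_worth.
move=> none; exfalso.
set r := #|a i'|; set c := cost p (a i') in cost_ai' gt_b.
have rk : (r <= max_courses E)%N by apply: card_permissible ai'.
have costD j : j \in a i' -> c = p j + cost p (a i' :\ j).
  by move=> ja; rewrite /c /cost (big_setD1 j).
(* The empty schedule costs 0, whereas [c] exceeds [b i >= 1]. *)
have r0 : (0 < r)%N.
  rewrite lt0n cards_eq0; apply/eqP => a0.
  by move: gt_b; rewrite /c a0 /cost big_set0; lra.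
(* Each [j] gives [1 <= b i < c - p j]. Summing yields [r + c < r * c], that is, [r < (r - 1) * c].
   With [c <= 1 + beta] this becomes [1 < (r - 1) * beta], against [beta <= 1 / (k - 1)] and
   [r <= k]. *)
have sum_lt : \sum_(j in a i') (1 + p j) < \sum_(j in a i') c.
  apply: ltr_sum => [|j ja].
    by have /card_gt0P[j ja] := r0; apply/hasP; exists j; rewrite ?mem_index_enum.
  have := none j; rewrite inE ja /= => /negbT.
  by rewrite -ltNge (costD j ja) => lt_b; lra.
rewrite big_split /= -/(cost p (a i')) -/c !sumr_const -/r -[c *+ r]mulr_natr in sum_lt.
have rE : r%:R = r.-1%:R + 1 :> R by rewrite -[in LHS](prednK r0) -natr1.
rewrite rE in sum_lt.
have r1_ge0 : 0 <= r.-1%:R :> R by [].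
(* For [r = 1] the sum would read [1 + c < c]. Hence [k > 1], and the bound on [beta] becomes
   available. *)
have r1 : (1 < r)%N.
  rewrite -(prednK r0) ltnS lt0n; apply/eqP => r1; rewrite r1 in sum_lt; lra.
have k1 := leq_trans r1 rk; have := hbeta k1.
have kE : (max_courses E)%:R = (max_courses E).-1%:R + 1 :> R.
  by rewrite natr1 prednK // ltnW.
have r1k1 : r.-1%:R <= (max_courses E).-1%:R :> R by rewrite ler_nat -!subn1 leq_sub2r.
have k1_gt0 : 0 < (max_courses E).-1%:R :> R.
  by rewrite ltr0n -subn1 subn_gt0.
rewrite kE addrK ler_pdivlMr // => beta_le.
have : r.-1%:R * c <= r.-1%:R * (1 + beta) by rewrite ler_wpM2l // (le_trans cost_ai').
have : beta * r.-1%:R <= beta * (max_courses E).-1%:R by rewrite ler_wpM2l // ltW.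
lra.
Qed.

Lemma aceei_maximin delta : permissible_worth E ->
  maximin_budget_condition E beta delta b p ->
  maximin_guarantee E n.+1 (2 * eps) a.
Proof.
move=> pw [d0 [_ budget] lt_beta] i s [z [[zsplit _] _ smin]].
have [[_ hb] p0 _ _ _] := eqm.
have n0 : 0 < n%:R :> R by rewrite ltr0n (students_gt0 E).
(* Cleared of its denominator, the bound says [n * (1 + beta) * (1 + delta) < n + 1]. *)
rewrite ltr_pdivlMr in lt_beta; last by rewrite mulr_gt0 // ltr_wpDr.
(* Course [j] occurs in at most [cap E j] parts of the split. *)
have total : \sum_(x <- z) cost p x <= \sum_(j < m) p j * (cap E j)%:R.
  rewrite /cost; under eq_bigr do rewrite big_mkcond.
  rewrite exchange_big /=; apply: ler_sum => j _.
  apply: le_trans (_ : p j * (\sum_(x <- z) (j \in x))%N%:R <= _); last first.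
    by rewrite ler_wpM2l // ler_nat zsplit.
  rewrite natr_sum mulr_sumr; apply: ler_sum => x _.
  by case: (j \in x); rewrite ?mulr1 ?mulr0.
have total_b : \sum_(k < n) b k * (1 + delta) <= n%:R * ((1 + beta) * (1 + delta)).
  rewrite -[n in n%:R]card_ord mulr_natl -sumr_const; apply: ler_sum => k _.
  by have /andP[_ ?] := hb k; rewrite ler_wpM2r // addr_ge0.
have [x xz x_b] : exists2 x, x \in z & cost p x <= b i.
  apply/hasP; apply: contraT => /hasPn none.
  have : \sum_(x <- z) 1 <= \sum_(x <- z) cost p x.
    rewrite big_seq [leRHS]big_seq; apply: ler_sum => x /none.
    by rewrite -ltNge => /ltW; apply: le_trans; have /andP[] := hb i.
  rewrite big_const_seq count_predT size_tuple iter_addr_0 -natr1.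
  lra.
rewrite lerBlDr; apply: le_trans (smin x xz) _.
exact: near_optimal_worth.
Qed.

Lemma aceei_utility i x : optimal (util E i) (permissible E i) p (b i) x ->
  `|util E i x - util E i (a i)| <= 2 * eps.
Proof.
move=> [xi xb x_opt]; have [_ _ opt _ _] := eqm; have [ai a_b _] := opt i.
by rewrite ger0_norm ?subr_ge0 ?x_opt // lerBlDl near_optimal.
Qed.

Lemma aceei_pareto : pareto_efficient_at E (2 * eps) b p a.
Proof.
move=> [a' [[_ a'i] le_b better]].
suff : \sum_(i < n) b i < \sum_(i < n) cost p (a' i) by rewrite ltNge le_b.
apply: ltr_sum => [|i _].
  (* Strictness survives summation because there is at least one student. *)
  by apply/hasP; exists (Ordinal (students_gt0 E)); rewrite // mem_index_enum.
rewrite ltNge; apply/negP => /(near_optimal (a'i i)).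
by rewrite leNgt better.
Qed.

End Equilibrium.

(** * A market attaining both bounds *)

Section TightMarket.
Variables (R : rcfType) (t : R).
Hypothesis t_gt0 : 0 < t.

Definition tight_util (i : 'I_2) (x : schedule 2) : R :=
  if (i == ord0) && (x != set0) then t else 0.

Lemma tight_util_ge0 i x : 0 <= tight_util i x.
Proof. by rewrite /tight_util; case: ifP => // _; exact: ltW. Qed.

Lemma tight_util_le i x : tight_util i x <= t.
Proof. by rewrite /tight_util; case: ifP => // _; exact: ltW. Qed.

(** Capacity 3 is [n + 1]: all three parts of a split can be the full schedule, so the maximin share
    of [ord0] is worth [t]. *)
Definition tight_market : market R 2 2 :=
  @Market R 2 2 (fun=> 3) (fun=> setT) tight_util
    isT (fun=> isT) tight_util_ge0.

(** The midpoint of the values 0 and [t] errs by [t / 2 < eps]; being constant, it makes every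
    affordable schedule optimal. *)
Definition tight_report (i : 'I_2) (x : schedule 2) : R := t / 2.

Definition tight_alloc : allocation 2 2 :=
  fun i => if i == ord0 then set0 else setT.

Definition tight_budget (i : 'I_2) : R := 1.

Definition tight_price (j : 'I_2) : R := 0.

Lemma tight_cost x : cost tight_price x = 0.
Proof. by rewrite /cost big1. Qed.

Lemma tight_worth : permissible_worth tight_market.
Proof. by move=> i x; right; exists x; rewrite inE. Qed.

Lemma tight_approx eps i : t < 2 * eps ->
  eps_approx eps (tight_report i) (util tight_market i).
Proof.
(* The default 0 of the maximum must lie below [eps] as well. *)
move=> lt_t; apply: bigmax_lt => [|x _]; first by move: t_gt0; lra.
have := tight_util_ge0 i x; have := tight_util_le i x.
rewrite /tight_report ltr_norml /= => *; move: t_gt0 => *.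
have : tight_util i x = 0 \/ tight_util i x = t.
  by rewrite /tight_util; case: ifP; [right | left].
by case=> ->; apply/andP; split; lra.
Qed.

Lemma tight_aceei :
  is_aceei tight_market tight_report 0 (4^-1) tight_alloc tight_budget tight_price.
Proof.
split=> //.
- by split=> [|i]; rewrite ?invr_gt0 // /tight_budget; apply/andP; split; lra.
- move=> i; split=> [||y _ _]; rewrite ?inE ?tight_cost ?ler01 //.
(* At price 0 only overenrolment counts, and one student fits into every course. *)
- rewrite big1 ?sqrtr0 // => j _; rewrite /clearing_error ltxx max_r ?expr0n //.
  by rewrite subr_le0 ler_nat /enrolled !big_ord_recl big_ord0 /= in_set0 in_setT.
- by rewrite divr_ge0 ?sqrtr_ge0.
Qed.

Lemma tight_envy_budget : envy_budget_condition tight_market (4^-1).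
Proof.
move=> k1; have k2 : (max_courses tight_market <= 2)%N.
  apply/bigmax_leqP => i _; apply/bigmax_leqP => x _.
  by rewrite -[leqRHS]card_ord max_card.
have -> : max_courses tight_market = 2 by apply/eqP; rewrite eqn_leq k2.
by rewrite -(@natrB R 2 1) // divr1; lra.
Qed.

Lemma tight_envy (eta : R) : 0 <= eta < t -> ~ envy_bounded tight_market eta tight_alloc.
Proof.
move=> /andP[eta0 lt_t] /(_ ord0 ord_max); rewrite /= /tight_util /tight_alloc /= eqxx /=.
have T0 : [set: 'I_2] != set0 by rewrite -card_gt0 cardsT card_ord.
rewrite T0 => -[|[j _]]; first by lra.
(* The second course keeps the envied schedule nonempty, so it is still worth [t]. *)
have -> : [set: 'I_2] :\ j != set0.
  by rewrite -card_gt0 setTD cardsC1 card_ord.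
by rewrite /=; lra.
Qed.

Lemma tight_maximin_budget :
  maximin_budget_condition tight_market (4^-1) 0 tight_budget tight_price.
Proof.
split=> //; last by rewrite mul0r subr0 addr0 mulr1 mul1r; lra.
split=> [j|]; first by rewrite lexx bigmax_ge_id.
rewrite big1 => [|j _]; last by rewrite mul0r.
by apply: sumr_ge0 => i _; rewrite addr0 mulr1.
Qed.

Lemma tight_maximin (eta : R) : 0 <= eta < t ->
  ~ maximin_guarantee tight_market 3 eta tight_alloc.
Proof.
move=> /andP[eta0 lt_t] /(_ ord0 setT).
have uT : tight_util ord0 setT = t.
  by rewrite /tight_util -card_gt0 cardsT card_ord.
have u0 : tight_util ord0 set0 = 0 by rewrite /tight_util !eqxx.
rewrite /= uT u0 => share; have : t - eta <= 0; last by lra.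
apply: share.
exists (nseq_tuple 3 setT); split.
- split=> [j|z' _]; first by rewrite /= !big_cons big_nil in_setT.
  apply: (@le_trans _ _ t); last first.
    by rewrite /min_util /= !big_cons big_nil uT !minxx.
  rewrite /min_util; apply: (big_ind (fun y => y <= t)) => [|y y' le_y _|x _].
  + exact: tight_util_le.
  + by rewrite ge_min le_y.
  + exact: tight_util_le.
- by rewrite mem_nseq eqxx.
- by move=> x; rewrite mem_nseq => /eqP ->.
Qed.

End TightMarket.

Theorem mainTheorem2 (R : rcfType) :
  [/\ forall (n m : nat) (E : market R n m) (v : 'I_n -> schedule m -> R)
        (eps alpha beta : R) (a : allocation n m) (b : 'I_n -> R)
        (p : 'I_m -> R),
        0 <= eps ->
        (forall i, eps_approx eps (v i) (util E i)) ->
        is_aceei E v alpha beta a b p ->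
        [/\ permissible_worth E -> envy_budget_condition E beta ->
              envy_bounded E (2 * eps) a,
            permissible_worth E ->
              (exists delta, maximin_budget_condition E beta delta b p) ->
              maximin_guarantee E n.+1 (2 * eps) a,
            forall i x, optimal (util E i) (permissible E i) p (b i) x ->
              `|util E i x - util E i (a i)| <= 2 * eps &
            pareto_efficient_at E (2 * eps) b p a],
      forall eps eta : R, 0 <= eta < 2 * eps ->
        exists (n m : nat) (E : market R n m) (v : 'I_n -> schedule m -> R)
          (alpha beta : R) (a : allocation n m) (b : 'I_n -> R) (p : 'I_m -> R),
          [/\ permissible_worth E,
              forall i, eps_approx eps (v i) (util E i),
              is_aceei E v alpha beta a b p,
              envy_budget_condition E beta &
              ~ envy_bounded E eta a] &
      forall eps eta : R, 0 <= eta < 2 * eps ->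
        exists (n m : nat) (E : market R n m) (v : 'I_n -> schedule m -> R)
          (alpha beta : R) (a : allocation n m) (b : 'I_n -> R) (p : 'I_m -> R),
          [/\ permissible_worth E,
              forall i, eps_approx eps (v i) (util E i),
              is_aceei E v alpha beta a b p,
              exists delta, maximin_budget_condition E beta delta b p &
              ~ maximin_guarantee E n.+1 eta a]].
Proof.
split=> [n m E v eps alpha beta a b p eps0 approx eqm|eps eta|eps eta].
- split=> [pw|pw [delta]|i x|].
  + exact: aceei_envy eps0 approx eqm pw.
  + exact: aceei_maximin eps0 approx eqm delta pw.
  + exact: aceei_utility approx eqm i x.
  + exact: aceei_pareto approx eqm.
all: move=> /andP[eta0 lt_eta].
(* The midpoint of [eta] and [2 * eps] lies strictly between them. *)
all: have t_gt0 : 0 < (eta + 2 * eps) / 2 by lra.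
(* The value [4^-1] of [beta] meets both budget conditions, which here ask for at most 1 ([k = 2])
   and less than 1/2 ([n = 2], [delta = 0]). *)
all: exists 2, 2, (tight_market t_gt0), (tight_report ((eta + 2 * eps) / 2)), 0, 4^-1.
all: exists tight_alloc, (@tight_budget R), (@tight_price R).
- split; [exact: tight_worth| | exact: tight_aceei | exact: tight_envy_budget | ].
  + by move=> i; apply: tight_approx; lra.
  + by apply: tight_envy; rewrite eta0 /=; lra.
- split; [exact: tight_worth| | exact: tight_aceei | | ].
  + by move=> i; apply: tight_approx; lra.
  + by exists 0; apply: tight_maximin_budget.
  + by apply: tight_maximin; rewrite eta0 /=; lra.
Qed.
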